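(* Let $p$ be an odd prime, $\omega=e^{2\pi i/p}$, $A\in M_{r\times s}(\mathbb{Z}_p)$, $c\in\mathbb{Z}_p^r$, and let $\Gamma=\Gamma(A,c)$ be the solution group of the linear constraint system $Ax=c\bmod p$. Let $m\ge1$ and let $Q$ be a subgroup with $T_{(p)}\subset Q\subset T_{(p^m)}$ that is invariant under conjugation by $X$, and $N\ge1$. Then the linear constraint system admits a quantum solution $\eta:\Gamma\to K^{\otimes N}_Q(p)$ if and only if it admits a classical solution, i.e. a vector $x\in\mathbb{Z}_p^s$ with $Ax\equiv c\bmod p$ (equivalently, a homomorphism $\Gamma\to\mathbb{Z}_p$ sending $J$ to $1$).
   Context: The solution group $\Gamma(A,c)$ is the finitely presented group with generators $J,g_1,\dots,g_s$ and relations: $g_k^p=e$ for all $k$ and $J^p=e$; $Jg_kJ^{-1}g_k^{-1}=e$ for all $k$, and $g_jg_kg_j^{-1}g_k^{-1}=e$ whenever there is a row $i$ with $A_{ij}\neq0$ and $A_{ik}\neq0$; and $\prod_{j=1}^s g_j^{A_{ij}}=J^{c_i}$ for all $i\in\{1,\dots,r\}$. A quantum solution in a group $G$ of unitaries is a group homomorphism $\eta:\Gamma\to G$ with $\eta(J)=\omega\mathbbm{1}$. Let $\{|q\rangle:q\in\mathbb{Z}_p\}$ be the computational basis of $\mathbb{C}^p$, $X|q\rangle=|q+1\rangle$; for $\xi:\mathbb{Z}_p\to U(1)$, $S_\xi=\mathrm{diag}(\xi(0),\dots,\xi(p-1))$; $T=\{S_\xi:\prod_q\xi(q)=1\}$,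 $T_{(p^k)}=\{S\in T:S^{p^k}=\mathbbm{1}\}$. $K_Q(p)$ is the subgroup of $SU(p)$ generated by all $S_\xi X^b$ with $S_\xi\in Q$, $b\in\mathbb{Z}_p$, and $K_Q^{\otimes N}(p)$ is the group of $N$-fold Kronecker products $M_1\otimes\cdots\otimes M_N$ with $M_i\in K_Q(p)$. *)

(* Defs.v *)
From HB Require Import structures.
From mathcomp Require Import all_boot all_order all_algebra.
From mathcomp Require Import complex mxtens.
From mathcomp Require Import reals Rstruct trigo.

Set Implicit Arguments.
Unset Strict Implicit.
Unset Printing Implicit Defensive.

Import GRing.Theory Num.Theory.
Local Open Scope ring_scope.

Definition Cplx : Type := (Rdefinitions.R)[i].

Definition omega (p : nat) : Cplx :=
  (cos (2 * pi / p%:R) +i* sin (2 * pi / p%:R))%C.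

Definition mxpow {n : nat} (A : 'M[Cplx]_n) (k : nat) : 'M[Cplx]_n :=
  iter k (mulmx A) 1%:M.

(* Shift matrix X |q> = |q+1>  (indices in Z_p represented by 'I_p). *)
Definition Xmx (p : nat) : 'M[Cplx]_p :=
  \matrix_(i < p, j < p) (((i : nat) == (j.+1 %% p)%N)%:R).

Definition Smx (p : nat) (xi : 'I_p -> Cplx) : 'M[Cplx]_p :=
  diag_mx (\row_(q < p) xi q).

Definition inT (p : nat) (S : 'M[Cplx]_p) : Prop :=
  exists xi : 'I_p -> Cplx,
    S = Smx xi /\ (forall q, `|xi q| = 1) /\ \prod_(q < p) xi q = 1.

Definition inTpk (p k : nat) (S : 'M[Cplx]_p) : Prop :=
  inT S /\ mxpow S (p ^ k) = 1%:M.
Arguments inTpk : clear implicits.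

(* Q is a subgroup (of the unitary matrices, here: of T, given Q ⊂ T). *)
Definition is_subgroup {n : nat} (Q : 'M[Cplx]_n -> Prop) : Prop :=
  [/\ Q 1%:M,
      (forall A B, Q A -> Q B -> Q (A *m B)) &
      (forall A, Q A -> Q (invmx A))].

Inductive gen_by {n : nat} (G : 'M[Cplx]_n -> Prop) : 'M[Cplx]_n -> Prop :=
  | gen_one : gen_by G 1%:M
  | gen_gen A : G A -> gen_by G A
  | gen_mul A B : gen_by G A -> gen_by G B -> gen_by G (A *m B)
  | gen_inv A : gen_by G A -> gen_by G (invmx A).

Definition inK (p : nat) (Q : 'M[Cplx]_p -> Prop) : 'M[Cplx]_p -> Prop :=
  gen_by (fun M => exists (S : 'M[Cplx]_p) (b : 'I_p),
                     Q S /\ M = S *m mxpow (Xmx p) b).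

Fixpoint kron_rec {p : nat} (M : nat -> 'M[Cplx]_p) (k : nat)
  : 'M[Cplx]_(p ^ k.+1) :=
  if k is k'.+1 then M 0%N *t kron_rec (fun i => M i.+1) k' else M 0%N.

Definition kronN {p : nat} (M : nat -> 'M[Cplx]_p) (N : nat)
  : 'M[Cplx]_(p ^ N) :=
  if N is N'.+1 return 'M[Cplx]_(p ^ N) then kron_rec M N' else 1%:M.

Definition inKN (p : nat) (Q : 'M[Cplx]_p -> Prop) (N : nat)
  (G : 'M[Cplx]_(p ^ N)) : Prop :=
  exists M : nat -> 'M[Cplx]_p,
    (forall i, (i < N)%N -> inK Q (M i)) /\ G = kronN M N.
Arguments inKN {p} Q N G.

(* A quantum solution eta : Gamma(A,c) -> K_Q^{⊗N}(p) with eta(J) = omega 1,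
   given by the images g k = eta(g_k) of the generators, which must lie in the
   target group and satisfy all defining relations of Gamma(A,c). *)
Definition quantum_solution (p r s : nat) (A : 'M['Z_p]_(r, s)) (c : 'cV['Z_p]_r)
  (Q : 'M[Cplx]_p -> Prop) (N : nat) (g : 'I_s -> 'M[Cplx]_(p ^ N)) : Prop :=
  let J : 'M[Cplx]_(p ^ N) := (omega p)%:M in
  inKN Q N J /\
  (forall k, inKN Q N (g k)) /\
  (forall k, mxpow (g k) p = 1%:M) /\
  mxpow J p = 1%:M /\
  (forall k, J *m g k *m invmx J *m invmx (g k) = 1%:M) /\
  (forall j k, (exists i, A i j != 0 /\ A i k != 0) ->
       g j *m g k *m invmx (g j) *m invmx (g k) = 1%:M) /\
  (forall i, \big[mulmx/1%:M]_(j < s) mxpow (g j) (A i j : nat)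
             = mxpow J (c i 0 : nat)).

Definition has_quantum_solution (p r s : nat) (A : 'M['Z_p]_(r, s))
  (c : 'cV['Z_p]_r) (Q : 'M[Cplx]_p -> Prop) (N : nat) : Prop :=
  exists g : 'I_s -> 'M[Cplx]_(p ^ N), quantum_solution A c Q g.

Definition has_classical_solution (p r s : nat) (A : 'M['Z_p]_(r, s))
  (c : 'cV['Z_p]_r) : Prop :=
  exists x : 'cV['Z_p]_s, A *m x = c.

(* Main.v *)
(** Every element of K_Q is a monomial matrix M = S_xi X^b with det S_xi = 1.
Such matrices carry a "symbol" sigma(M) in C with

  M M' = mu M' M  ==>  sigma(M M') = mu^(1/2) sigma(M) sigma(M'),
  sigma(c M) = c sigma(M),

where 1/2 is the inverse of 2 mod p (this is where p odd enters). When
M_1 (x) ... (x) M_N and M'_1 (x) ... (x) M'_N commute, the factors commute up to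
scalars mu_i of product 1, so the product of the symbols is well defined on
K_Q^(x)N and multiplicative on commuting pairs, and it sends omega 1 to omega.
Applied to the images of the generators g_k it gives p-th roots of unity
omega^(x_k), and x is a classical solution.

For diagonal S_xi the symbol is xi(0). For b <> 0 write S_xi X^b = D X^b D^-1
with D diagonal, unique up to a scalar; any monomial matrix commuting with it up
to a scalar is D (omega^l Z^a X^b') D^-1, and conjugation by a quadratic phase
turns X^b into omega^l Z^a X^b, so the symbol is determined on this Heisenberg
group by its value on D X D^-1. The entry of D X D^-1 at (1/2, -1/2) is the Weyl
normalisation of X, and projecting it equivariantly onto the p-th roots of unity
makes powers with exponents in Z_p meaningful. *)

Require Import Defs.
From HB Require Import structures.
From mathcomp Require Import all_boot all_order all_algebra.
From mathcomp Require Import complex mxtens.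
From mathcomp Require Import reals Rstruct trigo.
From mathcomp Require Import ring.

Set Implicit Arguments.
Unset Strict Implicit.
Unset Printing Implicit Defensive.

Import Order.TTheory GRing.Theory Num.Theory.
Local Open Scope ring_scope.

(** * The symbol of a monomial matrix *)

Section WeylSymbol.

Variables (C : numClosedFieldType) (n : nat) (w0 : C).
Local Notation p := n.+2.
Hypotheses (p_prime : prime p) (p_odd : odd p) (w0P : p.-primitive_root w0).
Implicit Types (a b l q : 'I_p) (d xi : 'I_p -> C) (z : C).

(** * Arithmetic of Z_p and powers of a primitive root *)

Let unitI b : b != 0 -> b \is a GRing.unit.
Proof.
move=> b0; rewrite -[b]natr_Zp; rewrite (unitZpE (p := p)) // prime_coprime //.
by rewrite gtnNdvd // lt0n.
Qed.

Let h : 'I_p := 2%:R^-1.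

Let hh : h + h = 1.
Proof.
by rewrite -mulr2n -mulr_natl divrr // (unitZpE (p := p)) // coprimen2.
Qed.

Let natZp0 : p%:R = 0 :> 'I_p.
Proof. exact: (@pchar_Zp p). Qed.

Definition root_pow a : C := w0 ^+ a.
Local Notation w := root_pow.

Lemma root_powD a b : w (a + b) = w a * w b.
Proof. by rewrite /w -exprD /= (prim_expr_mod w0P). Qed.

Lemma root_powM a b : w (a * b) = w a ^+ b.
Proof. by rewrite /w -exprM /= (prim_expr_mod w0P). Qed.

Lemma root_pow0 : w 0 = 1. Proof. by []. Qed.

Lemma root_pow_order a : w a ^+ p = 1.
Proof. by rewrite /w exprAC (prim_expr_order w0P) expr1n. Qed.

Lemma root_pow_neq0 a : w a != 0.
Proof.
by apply: contra_eqN (root_pow_order a) => /eqP ->; rewrite expr0n eq_sym oner_eq0.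
Qed.

Lemma root_powN a : w (- a) = (w a)^-1.
Proof.
apply: (mulfI (root_pow_neq0 a)).
by rewrite -root_powD subrr mulfV ?root_pow_neq0.
Qed.

Lemma root_pow_inj : injective w.
Proof.
move=> a b /eqP; rewrite /w (eq_prim_root_expr w0P) !modn_small ?ltn_ord //.
by move/eqP/val_inj.
Qed.

Lemma root_powP z : z ^+ p = 1 -> exists a, z = w a.
Proof. by move/(prim_rootP w0P) => [a ->]; exists a. Qed.

Lemma expr_ord_mod z (k : nat) : z ^+ p = 1 -> z ^+ (k %% p) = z ^+ k.
Proof. by move=> zp; rewrite {2}(divn_eq k p) exprD mulnC exprM zp expr1n mul1r. Qed.

Lemma expr_ordD z a b : z ^+ p = 1 -> z ^+ (a + b)%R = z ^+ a * z ^+ b.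
Proof. by move=> zp; rewrite -exprD /= expr_ord_mod. Qed.

(* A retraction of C^* onto the p-th roots of unity, equivariant under them. *)
Definition unit_phase z : C := z / p.-root (z ^+ p).
Local Notation rho := unit_phase.

Lemma unit_phase_order z : z != 0 -> rho z ^+ p = 1.
Proof. by move=> z0; rewrite expr_div_n rootCK // divff ?expf_neq0. Qed.

Lemma unit_phaseM z u : z ^+ p = 1 -> rho (z * u) = z * rho u.
Proof. by move=> zp; rewrite /rho exprMn zp mul1r mulrA. Qed.

(* The diagonal part of D X^b D^-1 for D = diag(d). *)
Definition coboundary d b q : C := d q / d (q - b).

(* The diagonal part of D (omega^l Z^a X^b) D^-1. *)
Definition twist d a b l q : C := w (a * q + l) * coboundary d b q.

(** A relation, since for nonzero [b] the diagonal [d] is determined only up to a scalar. As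
    [h - 1 = - h], the ratio [d h / d (- h)] is [coboundary d 1 h], the distinguished entry of D X
    D^-1. *)
Definition symbol b xi z : Prop :=
  if b == 0 then z = xi 0
  else exists d, [/\ forall q, d q != 0, xi =1 coboundary d b &
                     z = rho (d h / d (- h)) ^+ b].

Lemma eq_symbol b xi xi' z : xi =1 xi' -> symbol b xi z -> symbol b xi' z.
Proof.
rewrite /symbol => e; case: ifP => _; first by rewrite e.
by case=> d [d0 ed ->]; exists d; split=> // q; rewrite -e.
Qed.

(** The ratio [c] of two admissible diagonals is invariant under the shift by [b], which generates
    Z_p; hence it is constant and cancels in [d h / d (- h)]. *)
Lemma symbol_inj b xi z z' : symbol b xi z -> symbol b xi z' -> z = z'.
Proof.
rewrite /symbol; case: ifP => [_ -> -> //|/negbT b0].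
case=> d [d0 ed ->] [d' [d'0 ed' ->]].
pose c q := d q / d' q.
have cb q : c (q - b) = c q.
  have := ed q; rewrite ed' /coboundary => E.
  rewrite /c; apply/eqP; rewrite eqr_div //.
  move/eqP: E; rewrite eqr_div // => /eqP E.
  by rewrite mulrC -E mulrC.
have ck k q : c (q - b *+ k) = c q.
  by elim: k => [|k IH]; rewrite ?mulr0n ?subr0 // mulrSr opprD addrA cb.
have cc q : c q = c 0.
  rewrite -(ck (q / b : 'I_p) q) -mulr_natr natr_Zp mulrC divrK ?subrr //.
  exact: unitI.
congr (rho _ ^+ b).
have := cc h; rewrite -(cc (- h)) /c => /eqP; rewrite eqr_div // => /eqP E.
by apply/eqP; rewrite eqr_div // E mulrC.
Qed.

Lemma prod_ord_mulr (F : 'I_p -> C) b : b != 0 -> \prod_q F q = \prod_q F (b * q).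
Proof.
move=> /unitI bu; rewrite (reindex_inj (h := *%R b)) //.
exact: mulrI.
Qed.

Lemma prod_neq0 xi : \prod_q xi q = 1 -> forall q, xi q != 0.
Proof.
move=> xi1 q; apply: contra_eqN xi1 => /eqP xq.
by rewrite (bigD1 q) //= xq mul0r eq_sym oner_neq0.
Qed.

Lemma symbol_exists b xi : \prod_q xi q = 1 -> exists z, symbol b xi z.
Proof.
move=> xi1; rewrite /symbol; case: (eqVneq b 0) => [_|b0]; first by exists (xi 0).
have xi0 := prod_neq0 xi1.
have bu := unitI b0.
(* The recursion [d q = d (q - b) * xi q] is solved along the cycle 0, b, 2b, ...; [D k] is the
   value at [b * k]. *)
pose D (k : nat) := \prod_(i < k) xi (b * i.+1%:R).
have D0 k : D k != 0 by apply/prodf_neq0.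
have DS k : D k.+1 = D k * xi (b * k.+1%:R) by rewrite /D big_ord_recr.
have Dp : D p = 1.
  rewrite -xi1 (prod_ord_mulr xi b0).
  rewrite [RHS](reindex_inj (h := fun i => i + 1)) /=; last exact: addIr.
  apply: eq_bigr => i _; congr (xi (b * _)).
  by rewrite -natr1 natr_Zp.
suff [d [d0 ed]] : exists d, (forall q, d q != 0) /\ xi =1 coboundary d b.
  by exists (rho (d h / d (- h)) ^+ b), d.
exists (fun q => D (b^-1 * q)); split=> // q; rewrite /coboundary.
have -> : xi q = xi (b * (b^-1 * q)) by rewrite mulrA divrr // mul1r.
have -> : b^-1 * (q - b) = b^-1 * q - 1 by rewrite mulrBr mulVr.
move: (b^-1 * q) => {}q; rewrite -[in LHS](subrK 1 q) -[in D q](subrK 1 q).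
move: (q - 1) => {}q.
(* At the wrap-around [q + 1 = 0] the value restarts at [D 0], which agrees with [D p] because the
   product of [xi] is 1. *)
have -> : D (q + 1)%R = D q.+1.
  rewrite /= [(1 %% _)%N]modn_small // addn1.
  case: (ltnP q.+1 p) => [qp|]; first by rewrite modn_small.
  rewrite leq_eqVlt ltnNge ltn_ord orbF => /eqP <-.
  by rewrite modnn Dp /D big_ord0.
by rewrite DS mulrAC divff // mul1r -natr1 natr_Zp.
Qed.

(** The term [a * b * h] is the Weyl phase that symmetrises the ordering in Z^a X^b. *)
Lemma symbol_twist d a b l : (forall q, d q != 0) ->
  symbol b (twist d a b l) (w (l + a * b * h) * rho (d h / d (- h)) ^+ b).
Proof.
move=> d0; rewrite /symbol; case: (eqVneq b 0) => [->|b0].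
  by rewrite /twist /coboundary subrr divff // !(mulr0, mul0r, addr0, add0r) expr0.
have bu := unitI b0.
(* The quadratic phase q |-> w (A q^2 + c q) conjugates X^b to omega^l Z^a X^b. *)
pose A := a * h / b; pose c := (l + a * b * h) / b.
have Ab : A * b = a * h by rewrite divrK.
have cb : c * b = l + a * b * h by rewrite divrK.
pose e q := w (A * q * q + c * q).
have e0 q : e q != 0 by apply: root_pow_neq0.
have a2 : a = a * h + a * h by rewrite -mulrDr hh mulr1.
exists (fun q => e q * d q); split=> [q|q|]; first by rewrite mulf_neq0.
- rewrite /twist /coboundary invfM mulrACA; congr (_ * _).
  rewrite -root_powN -root_powD; congr w.
  have -> : A * q * q + c * q - (A * (q - b) * (q - b) + c * (q - b)) =
      (A * b + A * b) * q - A * b * b + c * b by ring.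
  by rewrite Ab cb -a2; ring.
(* The quadratic term is even and cancels between [h] and [- h]; the linear one leaves [w c], whose
   [b]-th power is the required phase. *)
- have -> : e h * d h / (e (- h) * d (- h)) = w c * (d h / d (- h)).
    rewrite invfM mulrACA -root_powN -root_powD; congr (w _ * _).
    transitivity (c * (h + h)); last by rewrite hh mulr1.
    by ring.
  by rewrite (@unit_phaseM (w c)) ?root_pow_order // [RHS]exprMn -root_powM cb.
Qed.

(** * Multiplicativity of the symbol on pairs commuting up to a scalar *)

Lemma prod_shift d b : \prod_q d (q - b) = \prod_q d q.
Proof. by rewrite [RHS](reindex_inj (h := fun q => q - b)) //; apply: addIr. Qed.

(** Negation permutes Z_p and 2 is invertible, so the elements of Z_p sum to 0; the constant [l]
    contributes [p * l = 0]. *)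
Lemma prod_root_pow a l : \prod_q w (a * q + l) = 1.
Proof.
have sum0 : \sum_(q : 'I_p) q = 0.
  have E : \sum_(q : 'I_p) q = - \sum_(q : 'I_p) q.
    by rewrite {1}(reindex_inj (h := -%R)) ?sumrN //; apply: oppr_inj.
  by rewrite -[LHS]mul1r -hh mulrDl {1}E mulrN addNr.
have -> : \prod_q w (a * q + l) = w (\sum_(q : 'I_p) (a * q + l)).
  by rewrite (big_morph w root_powD root_pow0).
rewrite big_split /= -mulr_sumr sum0 mulr0 add0r sumr_const card_ord.
by rewrite -mulr_natr natZp0 mulr0.
Qed.

(** [eta] is the diagonal part of D^-1 S_xi X^b' D. Commutation with X^b up to [mu] makes it a
    geometric progression along shifts by [b]; closing the cycle gives [mu ^+ p = 1], and the unit
    product of [xi] gives [eta 0 ^+ p = 1]. *)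
Lemma twist_of_commuting d b b' xi mu : (forall q, d q != 0) -> b != 0 ->
    \prod_q xi q = 1 ->
    (forall q, coboundary d b q * xi (q - b) =
               mu * (xi q * coboundary d b (q - b'))) ->
  exists a l, xi =1 twist d a b' l.
Proof.
move=> d0 b0 xi1 comm; have xi0 := prod_neq0 xi1.
pose eta q := xi q * (d (q - b') / d q).
have eta0 q : eta q != 0 by rewrite !mulf_neq0 ?invr_eq0.
have step q : eta (q - b) = mu * eta q.
  have := comm q; rewrite /eta /coboundary => E.
  rewrite mulrA -[xi (q - b)](mulKf (d0 q)) -[d q * _](divfK (d0 (q - b))).
  rewrite [d q * _ / _]mulrAC E [q - b' - b]addrAC.
  by field; rewrite !d0.
have steps k q : eta (q - b *+ k) = mu ^+ k * eta q.
  elim: k => [|k IH]; first by rewrite mulr0n subr0 mul1r.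
  by rewrite mulrSr opprD addrA step IH exprS mulrA.
have /root_powP [m muE] : mu ^+ p = 1.
  apply: (mulIf (eta0 0)); rewrite -steps -mulr_natr natZp0 mulr0 subr0.
  by rewrite mul1r.
have bu := unitI b0; pose a := - (m / b).
have etaE q : eta q = w (a * q) * eta 0.
  have := steps (q / b : 'I_p) q; rewrite -mulr_natr natr_Zp mulrC divrK // subrr.
  rewrite muE -root_powM => ->; rewrite mulrA -root_powD.
  have -> : a * q + m * (q / b) = 0 by rewrite /a; ring.
  by rewrite mul1r.
have /root_powP [l eta0E] : eta 0 ^+ p = 1.
  transitivity (\prod_q eta q).
    under [RHS]eq_bigr do rewrite etaE -[a * _]addr0.
    by rewrite big_split /= prod_root_pow mul1r prodr_const card_ord.
  rewrite big_split /= xi1 mul1r big_split /= prod_shift -big_split /=.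
  by apply: big1 => q _; rewrite divff.
exists a, l => q; rewrite /twist root_powD -eta0E -etaE /eta /coboundary.
by field; rewrite !d0.
Qed.

(** The Heisenberg group law: the phase [- a' * b] comes from moving X^b past Z^a'. *)
Lemma twistM d a b l a' b' l' q : (forall q, d q != 0) ->
  twist d a b l q * twist d a' b' l' (q - b) =
  twist d (a + a') (b + b') (l + l' - a' * b) q.
Proof.
move=> d0; rewrite /twist mulrACA -root_powD; congr (w _ * _); first by ring.
rewrite /coboundary opprD addrA; by field; rewrite !d0.
Qed.

Lemma symbolM_twist d a b l a' b' l' z z' mu : (forall q, d q != 0) ->
    symbol b (twist d a b l) z -> symbol b' (twist d a' b' l') z' ->
    (forall q, twist d a b l q * twist d a' b' l' (q - b) =
               mu * (twist d a' b' l' q * twist d a b l (q - b'))) ->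
  symbol (b + b') (fun q => twist d a b l q * twist d a' b' l' (q - b))
         (mu ^+ h * (z * z')).
Proof.
move=> d0 sz sz' comm.
rewrite (symbol_inj sz (symbol_twist _ _ _ d0)).
rewrite (symbol_inj sz' (symbol_twist _ _ _ d0)).
apply: (eq_symbol (fun q => esym (twistM a b l a' b' l' q d0))).
(* The two orders of multiplication differ only in the phases [- a' * b] and [- a * b'], so [mu] is
   the symplectic form. *)
have -> : mu = w (a * b' - a' * b).
  have := comm 0; rewrite !twistM // [b' + b]addrC /twist mulrA => E.
  have cb0 : coboundary d (b + b') 0 != 0 by rewrite mulf_neq0 ?invr_eq0.
  apply: (mulIf (root_pow_neq0 (l' + l - a * b'))).
  move/(mulIf cb0): E; rewrite !mulr0 !add0r => <-.
  by rewrite -root_powD; congr w; ring.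
have := symbol_twist (a + a') (b + b') (l + l' - a' * b) d0.
rewrite -root_powM expr_ordD; last first.
  by rewrite unit_phase_order // mulf_neq0 ?invr_eq0.
congr symbol; rewrite mulrACA [RHS]mulrA -!root_powD; congr (w _ * _).
(* The Weyl phase of the product exceeds the sum of the two Weyl phases by half the symplectic form,
   which is the factor [mu ^+ h]. *)
transitivity (l + l' + (a * b' - a' * b) * h + a * b * h + a' * b' * h
              + (a' * b * (h + h) - a' * b)); first by ring.
by rewrite hh mulr1 subrr addr0; ring.
Qed.

Lemma common_twist b xi z b' xi' mu : b != 0 -> symbol b xi z ->
    \prod_q xi' q = 1 ->
    (forall q, xi q * xi' (q - b) = mu * (xi' q * xi (q - b'))) ->
  exists d a l a' l', [/\ forall q, d q != 0, xi =1 twist d a b l &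
                          xi' =1 twist d a' b' l'].
Proof.
rewrite /symbol => b0; rewrite (negbTE b0) => -[d [d0 xiE _]] xi'1 comm.
have [q|a' [l' xi'E]] := @twist_of_commuting d b b' xi' mu d0 b0 xi'1.
  by rewrite -!xiE.
exists d, 0, 0, a', l'; split=> // q.
by rewrite xiE /twist mul0r addr0 root_pow0 mul1r.
Qed.

Lemma symbolM b xi z b' xi' z' mu :
    \prod_q xi q = 1 -> \prod_q xi' q = 1 ->
    symbol b xi z -> symbol b' xi' z' ->
    (forall q, xi q * xi' (q - b) = mu * (xi' q * xi (q - b'))) ->
  symbol (b + b') (fun q => xi q * xi' (q - b)) (mu ^+ h * (z * z')).
Proof.
move=> xi1 xi'1 sz sz' comm.
have xx0 q r : xi q * xi' r != 0.
  by rewrite mulf_neq0 ?(prod_neq0 xi1) ?(prod_neq0 xi'1).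
have mu0 : mu != 0.
  by have := xx0 0 (0 - b); apply: contraNneq => mu0; rewrite comm mu0 mul0r.
suff [/andP[/eqP b0 /eqP b'0]|[d [a [l [a' [l' [d0 xiE xi'E]]]]]]] :
    (b == 0) && (b' == 0) \/
    exists d a l a' l', [/\ forall q, d q != 0, xi =1 twist d a b l &
                            xi' =1 twist d a' b' l'].
- move: sz sz' comm; rewrite b0 b'0 /symbol addr0 eqxx => -> -> /(_ 0).
  rewrite !subr0 [xi' 0 * _]mulrC -{1}[_ * _]mul1r => /(mulIf (xx0 0 0)) <-.
  by rewrite expr1n mul1r.
- apply: (@eq_symbol _ (fun q => twist d a b l q * twist d a' b' l' (q - b))).
    by move=> q; rewrite xiE xi'E.
  apply: symbolM_twist => //; [exact: eq_symbol sz|exact: eq_symbol sz'|].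
  by move=> q; rewrite -!xiE -!xi'E.
case: (eqVneq b 0) => [b0|b0]; last by right; apply: common_twist b0 sz xi'1 comm.
case: (eqVneq b' 0) => [b'0|b'0]; [by left|right].
(* Here the second matrix is the non-diagonal one and supplies [d]; exchanging the roles inverts
   [mu]. *)
have [q|d [a' [l' [a [l [d0 xi'E xiE]]]]]] :=
    @common_twist b' xi' z' b xi mu^-1 b'0 sz' xi1.
  by rewrite comm mulKf.
by exists d, a, l, a', l'.
Qed.

(** * Monomial matrices S_xi X^b and their symbols *)

Definition monomial b xi : 'M[C]_p := \matrix_(i, j) (xi i * (j == i - b)%:R).

Lemma mul_monomial b xi b' xi' :
  monomial b xi *m monomial b' xi' = monomial (b + b') (fun q => xi q * xi' (q - b)).
Proof.
apply/matrixP => i j; rewrite !mxE (bigD1 (i - b)) //= !mxE eqxx mulr1.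
rewrite big1 ?addr0 => [|k kb]; last by rewrite !mxE (negbTE kb) mulr0 mul0r.
by rewrite mulrA opprD addrA.
Qed.

Lemma eq_monomial b xi xi' : xi =1 xi' -> monomial b xi = monomial b xi'.
Proof. by move=> e; apply/matrixP => i j; rewrite !mxE e. Qed.

Lemma monomial_inj b xi b' xi' : (forall q, xi q != 0) ->
  monomial b xi = monomial b' xi' -> b = b' /\ xi =1 xi'.
Proof.
move=> xi0 /matrixP E.
have bb : b = b'.
  have := E 0 (0 - b); rewrite !mxE eqxx mulr1 !sub0r eqr_opp.
  case: eqP => // _ /eqP; by rewrite mulr0 (negbTE (xi0 0)).
by split=> // q; have := E q (q - b); rewrite !mxE bb eqxx !mulr1.
Qed.

Lemma scalar_monomial z : z%:M = monomial 0 (fun=> z).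
Proof.
by apply/matrixP => i j; rewrite !mxE subr0 eq_sym mulr_natr.
Qed.

Lemma scale_monomial z b xi : z *: monomial b xi = monomial b (fun q => z * xi q).
Proof. by apply/matrixP => i j; rewrite !mxE mulrA. Qed.

Definition in_monomials (M : 'M[C]_p) : Prop :=
  exists b xi, \prod_q xi q = 1 /\ M = monomial b xi.

Lemma in_monomialsM M M' :
  in_monomials M -> in_monomials M' -> in_monomials (M *m M').
Proof.
move=> [b [xi [xi1 ->]]] [b' [xi' [xi'1 ->]]]; rewrite mul_monomial.
exists (b + b'), (fun q => xi q * xi' (q - b)); split=> //.
by rewrite big_split /= xi1 mul1r prod_shift.
Qed.

Lemma in_monomials_scalar z : z ^+ p = 1 -> in_monomials z%:M.
Proof.
move=> zp; exists 0, (fun=> z); split; last exact: scalar_monomial.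
by rewrite prodr_const card_ord.
Qed.

Lemma in_monomialsV M : in_monomials M -> in_monomials (invmx M).
Proof.
move=> [b [xi [xi1 ->]]]; exists (- b), (fun q => (xi (q + b))^-1); split.
  rewrite -[RHS]invr1 -[in RHS]xi1 -prodfV -[RHS](prod_shift _ (- b)).
  by apply: eq_bigr => q _; rewrite opprK.
have inv1 : monomial b xi *m monomial (- b) (fun q => (xi (q + b))^-1) = 1%:M.
  rewrite mul_monomial subrr scalar_monomial; apply: eq_monomial => q.
  by rewrite subrK divff // (prod_neq0 xi1).
have [xi_unit _] := mulmx1_unit inv1.
by rewrite -[RHS]mul1mx -(mulVmx xi_unit) -mulmxA inv1 mulmx1.
Qed.

Lemma in_monomials_neq0 M : in_monomials M -> M != 0.
Proof.
move=> [b [xi [xi1 ->]]]; apply: contraNneq (prod_neq0 xi1 0) => /matrixP E.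
by have := E 0 (0 - b); rewrite !mxE eqxx mulr1 => ->.
Qed.

Definition mx_symbol (M : 'M[C]_p) z : Prop :=
  exists b xi, [/\ \prod_q xi q = 1, M = monomial b xi & symbol b xi z].

Lemma mx_symbol_monomial M z : mx_symbol M z -> in_monomials M.
Proof. by case=> b [xi [xi1 -> _]]; exists b, xi. Qed.

Lemma mx_symbol_exists M : in_monomials M -> exists z, mx_symbol M z.
Proof.
by move=> [b [xi [xi1 ->]]]; have [z sz] := symbol_exists b xi1; exists z, b, xi.
Qed.

Lemma mx_symbol_inj M z z' : mx_symbol M z -> mx_symbol M z' -> z = z'.
Proof.
move=> [b [xi [xi1 -> sz]]] [b' [xi' [xi'1 /(monomial_inj (prod_neq0 xi1)) []]]].
by move=> <- e /(eq_symbol (fsym e)); apply: symbol_inj.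
Qed.

Lemma mx_symbolM M z M' z' mu : mx_symbol M z -> mx_symbol M' z' ->
  M *m M' = mu *: (M' *m M) -> mx_symbol (M *m M') (mu ^+ h * (z * z')).
Proof.
move=> [b [xi [xi1 -> sz]]] [b' [xi' [xi'1 -> sz']]] /matrixP E.
exists (b + b'), (fun q => xi q * xi' (q - b)); split.
- by rewrite big_split /= xi1 mul1r prod_shift.
- exact: mul_monomial.
apply: symbolM => // q; have := E q (q - (b + b')).
by rewrite !mul_monomial !mxE [b' + b]addrC eqxx !mulr1.
Qed.

Lemma mx_symbol_scalar z : z ^+ p = 1 -> mx_symbol z%:M z.
Proof.
move=> zp; exists 0, (fun=> z); split; last by rewrite /symbol eqxx.
  by rewrite prodr_const card_ord.
exact: scalar_monomial.
Qed.

Lemma mx_symbolZ M z c :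
  mx_symbol M z -> in_monomials (c *: M) -> mx_symbol (c *: M) (c * z).
Proof.
move=> sM [b' [xi' [xi'1]]]; have [b [xi [xi1 ME _]]] := sM.
rewrite {1}ME scale_monomial => /esym /(monomial_inj (prod_neq0 xi'1)) [_ xi'E].
(* Both diagonal parts have product 1, which forces [c] to be a p-th root of unity; scaling is then
   multiplication by a central matrix of symbol [c]. *)
have cp : c ^+ p = 1.
  move: xi'1; under eq_bigr do rewrite xi'E.
  by rewrite big_split /= xi1 mulr1 prodr_const card_ord.
have := mx_symbolM (mu := 1) (mx_symbol_scalar cp) sM.
by rewrite scalar_mxC mul_scalar_mx scale1r expr1n mul1r; apply.
Qed.

End WeylSymbol.

(** * Kronecker products *)

Section Kronecker.

Lemma matrix_neq0P (F : fieldType) m n (A : 'M[F]_(m, n)) :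
  A != 0 -> exists i j, A i j != 0.
Proof.
move=> A0; case: (pickP (fun ij => A ij.1 ij.2 != 0)) => [[i j] ?|A00].
  by exists i, j.
case/eqP: A0; apply/matrixP => i j; rewrite mxE.
by have /negbFE/eqP := A00 (i, j).
Qed.

Lemma tensmx_neq0 (F : fieldType) m1 n1 m2 n2 (A : 'M[F]_(m1, n1))
    (B : 'M[F]_(m2, n2)) : A != 0 -> B != 0 -> A *t B != 0.
Proof.
move=> /matrix_neq0P [i [j Aij]] /matrix_neq0P [k [l Bkl]].
apply: contraTneq Aij => /matrixP /(_ (mxtens_index (i, k)) (mxtens_index (j, l))).
by rewrite tensmxE mxE => /eqP; rewrite mulf_eq0 (negbTE Bkl) orbF negbK.
Qed.

Lemma tensmx_eq_scale (F : fieldType) m1 n1 m2 n2 (A A' : 'M[F]_(m1, n1))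
    (B B' : 'M[F]_(m2, n2)) c :
    A != 0 -> B != 0 -> c != 0 -> A' *t B' = c *: (A *t B) ->
  exists x y, [/\ A' = x *: A, B' = y *: B & x * y = c].
Proof.
move=> /matrix_neq0P [i [j Aij]] /matrix_neq0P [k [l Bkl]] c0 /matrixP E.
have {}E i' j' k' l' : A' i' j' * B' k' l' = c * (A i' j' * B k' l').
  have := E (mxtens_index (i', k')) (mxtens_index (j', l')).
  by rewrite tensmxE [RHS]mxE tensmxE.
have [A'ij B'kl] : A' i j != 0 /\ B' k l != 0.
  by apply/andP; rewrite -negb_or -mulf_eq0 E !mulf_neq0.
(* Ratios at fixed nonzero entries; by [E] the second one equals [B' k l / B k l]. *)
exists (A' i j / A i j), (c * A i j / A' i j); split; last by field; rewrite A'ij.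
  apply/matrixP => i' j'; rewrite mxE; apply: (mulIf B'kl).
  rewrite E mulrAC [_ / _ * _]mulrAC E; by field.
apply/matrixP => k' l'; rewrite mxE; apply: (mulfI A'ij).
by rewrite E; field.
Qed.

Lemma tensmx_scalar (F : comPzRingType) m n (a b : F) :
  (a%:M : 'M_m) *t (b%:M : 'M_n) = (a * b)%:M.
Proof.
apply/matrixP => i j.
case: (mxtens_indexP i) => i0 i1; case: (mxtens_indexP j) => j0 j1.
rewrite tensmxE !mxE (can_eq (@mxtens_indexK _ _)) xpair_eqE.
by case: (i0 == j0) (i1 == j1) => [] [] /=; rewrite ?mulr1n ?mulr0n ?(mulr0, mul0r).
Qed.

Variable p : nat.
Implicit Types M : nat -> 'M[Cplx]_p.

Lemma kron_recM k M M' :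
  kron_rec M k *m kron_rec M' k = kron_rec (fun i => M i *m M' i) k.
Proof. by elim: k M M' => //= k IH M M'; rewrite tensmx_mul IH. Qed.

Lemma kron_rec_neq0 k M : (forall i, (i < k.+1)%N -> M i != 0) -> kron_rec M k != 0.
Proof.
elim: k M => [|k IH] M M0 /=; first exact: M0.
by apply: tensmx_neq0; [exact: M0|apply: IH => i ik; apply: M0].
Qed.

(** Used with [c = 1] twice: to compare two factorisations of one matrix, and to turn commutation of
    Kronecker products into factorwise commutation up to scalars of product 1. *)
Lemma kron_rec_eq_scale k M M' c :
    (forall i, (i < k.+1)%N -> M i != 0) -> c != 0 ->
    kron_rec M' k = c *: kron_rec M k ->
  exists x : nat -> Cplx, (forall i, (i < k.+1)%N -> M' i = x i *: M i) /\
                          \prod_(i < k.+1) x i = c.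
Proof.
elim: k M M' c => [|k IH] M M' c M0 c0 /= E.
  by exists (fun=> c); split=> [[|i]|] //; rewrite big_ord1.
have Mk0 : kron_rec (fun i => M i.+1) k != 0.
  by apply: kron_rec_neq0 => i ik; apply: M0.
have [x [y [M0E Mk xy]]] := tensmx_eq_scale (M0 0%N isT) Mk0 c0 E.
have y0 : y != 0 by apply: contraNneq c0 => y0; rewrite -xy y0 mulr0.
have [i ik|u [uE up]] := IH _ _ _ _ y0 Mk; first exact: M0.
exists (fun i => if i is i'.+1 then u i' else x); split=> [[|i] //|]; first exact: uE.
by rewrite big_ord_recl /= -xy -up.
Qed.

End Kronecker.

(** * Primitivity of the root of unity omega *)

Section Omega.

Lemma cis_exp (x : Rdefinitions.R) k :
  ((cos x +i* sin x)%C : Cplx) ^+ k = (cos (x *+ k) +i* sin (x *+ k))%C.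
Proof.
elim: k => [|k IH]; first by rewrite !mulr0n cos0 sin0 expr0.
rewrite exprS IH mulrS cosD sinD.
by apply/eqP; rewrite eq_complex /= eqxx addrC [cos x * _]mulrC [sin x * _]mulrC addrC eqxx.
Qed.

Lemma omega_order p : (0 < p)%N -> omega p ^+ p = 1.
Proof.
move=> p0; rewrite /omega cis_exp.
have -> : 2 * pi / p%:R *+ p = pi *+ 2 :> Rdefinitions.R.
  by rewrite -[LHS]mulr_natr divfK ?pnatr_eq0 -?lt0n // mulr_natl.
by rewrite cos2pi sin2pi.
Qed.

(** The order divides the prime p; order 1 would give sin(2 pi / p) = 0, although 0 < 2 pi / p < pi
    for p > 2. *)
Lemma omega_primitive p : prime p -> odd p -> p.-primitive_root (omega p).
Proof.
move=> p_prime p_odd.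
have [k kP kp] := prim_order_exists (prime_gt0 p_prime) (omega_order (prime_gt0 p_prime)).
case/primeP: p_prime => p1 /(_ k kp) /orP[/eqP k1|/eqP kE]; last by rewrite -{1}kE.
have : omega p ^+ 1 = 1 by have := prim_expr_order kP; rewrite k1.
rewrite expr1 => /eqP; rewrite eq_complex /= => /andP[_ /eqP s0].
have p2 : (2 < p)%N by move: p1 p_odd; case: (p) => [|[|[|]]].
have := @sin_gt0_pi _ (2 * pi / p%:R : Rdefinitions.R); rewrite s0 ltxx.
have p0 : 0 < p%:R :> Rdefinitions.R by rewrite ltr0n; apply: leq_trans p2.
have pi0 := pi_gt0 Rdefinitions.R.
rewrite divr_gt0 ?mulr_gt0 //= ltr_pdivrMr // mulrC ltr_pM2l // ltr_nat p2.
by move/(_ isT).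
Qed.

Lemma norm_omega p : `|omega p| = 1.
Proof. by rewrite normc_def /= cos2Dsin2 sqrtr1. Qed.

End Omega.

(** * Quantum and classical solutions *)

Section Solutions.

Variable n : nat.
Local Notation p := n.+2.
Hypotheses (p_prime : prime p) (p_odd : odd p).

Let omegaP := omega_primitive p_prime p_odd.
Local Notation w := (root_pow (omega p)).

Lemma kron_rec_scalar k (z : Cplx) :
  kron_rec (fun i => if i is 0%N then z%:M else 1%:M : 'M[Cplx]_p) k = z%:M.
Proof.
case: k => //= k.
have -> : kron_rec (fun=> 1%:M : 'M[Cplx]_p) k = 1%:M.
  by elim: k => //= k ->; rewrite tensmx_scalar mulr1.
by rewrite tensmx_scalar mulr1.
Qed.

Lemma Xmx_monomial : Xmx p = monomial 1 (fun=> 1).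
Proof.
apply/matrixP => i j; rewrite !mxE mul1r; congr ((nat_of_bool _)%:R).
by rewrite [RHS]eq_sym subr_eq -val_eqE /= [(1 %% _)%N]modn_small // addn1.
Qed.

Lemma Smx_monomial (xi : 'I_p -> Cplx) : Smx xi = monomial 0 xi.
Proof.
by apply/matrixP => i j; rewrite !mxE subr0 eq_sym mulr_natr; case: eqP => // ->.
Qed.

Lemma inK_monomials (Q : 'M[Cplx]_p -> Prop) M :
  (forall S, Q S -> inT S) -> inK Q M -> in_monomials M.
Proof.
move=> QT; have M1 : in_monomials (1%:M : 'M[Cplx]_p).
  by apply: in_monomials_scalar; rewrite expr1n.
elim=> {M} [//|_ [S [b [/QT [xi [-> [_ xi1]]] ->]]]|A B _ KA _ KB|A _ KA].
- apply: in_monomialsM; first by exists 0, xi; rewrite Smx_monomial.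
  elim: (b : nat) => //= j IH; apply: in_monomialsM => //.
  by exists 1, (fun=> 1); rewrite Xmx_monomial big1.
- exact: in_monomialsM.
- exact: in_monomialsV.
Qed.

(** * The symbol on Kronecker products *)

Definition kron_symbol k (G : 'M[Cplx]_(p ^ k.+1)) (z : Cplx) : Prop :=
  exists M (zs : nat -> Cplx),
    [/\ forall i, (i < k.+1)%N -> mx_symbol (M i : 'M[Cplx]_p) (zs i),
        G = kron_rec M k & z = \prod_(i < k.+1) zs i].

Variable k : nat.
Implicit Types (G : 'M[Cplx]_(p ^ k.+1)) (z : Cplx).

Lemma kron_symbol_exists (Q : 'M[Cplx]_p -> Prop) G :
    (forall M, inK Q M -> in_monomials M) -> inKN Q k.+1 G ->
  exists z, kron_symbol G z.
Proof.
move=> QK [M [MK ->]].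
have /boolp.choice [zs zsP] i : exists z, (i < k.+1)%N -> mx_symbol (M i) z.
  (* Outside the range of factors the value 0 is a dummy. *)
  case: (ltnP i k.+1) => ik; last by exists 0.
  by have [z] := mx_symbol_exists p_prime (QK _ (MK i ik)); exists z.
by exists (\prod_(i < k.+1) zs i), M, zs.
Qed.

(** Two factorisations differ by scalars [x i] of product 1, and each symbol scales by its [x i]. *)
Lemma kron_symbol_inj G z z' : kron_symbol G z -> kron_symbol G z' -> z = z'.
Proof.
move=> [M [zs [Ms -> ->]]] [M' [zs' [Ms' E ->]]].
have M0 i : (i < k.+1)%N -> M i != 0.
  by move=> ik; exact: in_monomials_neq0 (mx_symbol_monomial (Ms i ik)).
have [x [xE x1]] : exists x : nat -> Cplx,
    (forall i, (i < k.+1)%N -> M' i = x i *: M i) /\ \prod_(i < k.+1) x i = 1.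
  by apply: kron_rec_eq_scale; rewrite ?oner_neq0 // scale1r.
transitivity (\prod_(i < k.+1) (x i * zs i)); first by rewrite big_split /= x1 mul1r.
apply: eq_bigr => i _.
have Mi' := Ms' i (ltn_ord i).
apply: (mx_symbol_inj p_prime _ Mi'); rewrite xE //.
apply: (mx_symbolZ p_prime p_odd omegaP (Ms i (ltn_ord i))).
by rewrite -xE //; apply: mx_symbol_monomial Mi'.
Qed.

(** Each factor picks up a half power of its commutation scalar [x i]; these scalars have product 1,
    so the corrections cancel overall. *)
Lemma kron_symbolM G z G' z' : kron_symbol G z -> kron_symbol G' z' ->
  comm_mx G G' -> kron_symbol (G *m G') (z * z').
Proof.
move=> [M [zs [Ms -> ->]]] [M' [zs' [Ms' -> ->]]]; rewrite /comm_mx !kron_recM => E.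
have MM0 i : (i < k.+1)%N -> M' i *m M i != 0.
  move=> ik; apply: in_monomials_neq0; apply: in_monomialsM.
    exact: mx_symbol_monomial (Ms' i ik).
  exact: mx_symbol_monomial (Ms i ik).
have [x [xE x1]] : exists x : nat -> Cplx,
    (forall i, (i < k.+1)%N -> M i *m M' i = x i *: (M' i *m M i)) /\
    \prod_(i < k.+1) x i = 1.
  by apply: kron_rec_eq_scale; rewrite ?oner_neq0 // scale1r.
exists (fun i => M i *m M' i), (fun i => x i ^+ (2%:R^-1 : 'I_p) * (zs i * zs' i)).
split=> [i ik||] //.
  by apply: (mx_symbolM p_prime p_odd omegaP (Ms i ik) (Ms' i ik)); apply: xE.
by rewrite !big_split /= prodrXl x1 expr1n mul1r.
Qed.

Lemma kron_symbol_scalar z : z ^+ p = 1 -> kron_symbol (z%:M : 'M[Cplx]_(p ^ k.+1)) z.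
Proof.
move=> zp.
exists (fun i => if i is 0%N then z%:M else 1%:M), (fun i => if i is 0%N then z else 1).
split; last by rewrite big_ord_recl big1 // mulr1.
  by case=> [|i] _; apply: mx_symbol_scalar => //; rewrite expr1n.
by rewrite kron_rec_scalar.
Qed.

Lemma comm_mxpow G G' j : comm_mx G G' -> comm_mx G (mxpow G' j).
Proof.
move=> GG'; elim: j => [|j IH]; first exact: comm_mx1.
exact: comm_mxM.
Qed.

Lemma kron_symbolX G z j : kron_symbol G z -> kron_symbol (mxpow G j) (z ^+ j).
Proof.
move=> Gz; elim: j => [|j IH]; first by apply: kron_symbol_scalar; rewrite expr1n.
by rewrite exprS; apply: kron_symbolM => //; apply: comm_mxpow.
Qed.

Lemma kron_symbol_prod (I : Type) (r : seq I) (g : I -> 'M[Cplx]_(p ^ k.+1)) (z : I -> Cplx) :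
    (forall i, kron_symbol (g i) (z i)) -> (forall i j, comm_mx (g i) (g j)) ->
  kron_symbol (\big[mulmx/1%:M]_(i <- r) g i) (\prod_(i <- r) z i).
Proof.
move=> gz gC; elim: r => [|i r IH].
  by rewrite !big_nil; apply: kron_symbol_scalar; rewrite expr1n.
rewrite !big_cons; apply: kron_symbolM => //.
elim: r {IH} => [|j r IH]; first by rewrite big_nil; apply: comm_mx1.
by rewrite big_cons; apply: comm_mxM.
Qed.

(** * Transfer between quantum and classical solutions *)

Lemma commutator_eq1 m (A B : 'M[Cplx]_m) : A \in unitmx -> B \in unitmx ->
  (A *m B *m invmx A *m invmx B = 1%:M) <-> comm_mx A B.
Proof.
move=> Au Bu; split=> [E|AB]; last by rewrite AB mulmxK // mulmxV.
rewrite /comm_mx -[RHS]mul1mx -E !mulmxA.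
by rewrite mulmxKV // mulmxKV.
Qed.

Lemma mxpow_unit m (A : 'M[Cplx]_m) j : mxpow A j.+1 = 1%:M -> A \in unitmx.
Proof. by case/mulmx1_unit. Qed.

Lemma mxpow_scalar m (z : Cplx) j : mxpow (z%:M : 'M_m) j = (z ^+ j)%:M.
Proof. by elim: j => //= j IH; rewrite IH -scalar_mxM exprS. Qed.

Lemma prod_root_powM (s : nat) (x a : 'I_s -> 'I_p) :
  \prod_j w (x j) ^+ a j = w (\sum_j a j * x j).
Proof.
rewrite (big_morph w (root_powD omegaP) (root_pow0 _ _)).
by apply: eq_bigr => j _; rewrite mulrC (root_powM omegaP).
Qed.

(** The symbol behaves as a homomorphism on commuting elements, which is enough to carry each row
    relation over to p-th roots of unity; the exponents of omega form [x]. *)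
Lemma quantum_to_classical r s (A : 'M['Z_p]_(r, s)) (c : 'cV['Z_p]_r)
    (Q : 'M[Cplx]_p -> Prop) :
    (forall S, Q S -> inT S) -> has_quantum_solution A c Q k.+1 ->
  has_classical_solution A c.
Proof.
move=> QT [g [_ [gK [gp [_ [_ [gC gE]]]]]]].
have /boolp.choice [z zP] j : exists z, kron_symbol (g j) z.
  apply: kron_symbol_exists (gK j).
  by move=> M; apply: inK_monomials.
have zp j : z j ^+ p = 1.
  have := kron_symbolX p (zP j); rewrite gp => /kron_symbol_inj; apply.
  by apply: kron_symbol_scalar; rewrite expr1n.
have /boolp.choice [x xP] j : exists a : 'I_p, z j = w a by apply: (root_powP omegaP) (zp j).
exists (\col_j x j); apply/matrixP => i o; rewrite (ord1 o) {o} !mxE.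
under eq_bigr do rewrite mxE.
apply: (root_pow_inj omegaP).
(* Commutation is given only on the support of row [i]; off the support the power is the identity,
   so all powers in the row commute. *)
have Cg j j' : comm_mx (mxpow (g j) (A i j)) (mxpow (g j') (A i j')).
  have [->|Aj] := eqVneq (A i j) 0; first exact/comm_mx_sym/comm_mx1.
  have [->|Aj'] := eqVneq (A i j') 0; first exact: comm_mx1.
  apply: comm_mxpow; apply: comm_mx_sym; apply: comm_mxpow; apply: comm_mx_sym.
  by apply/commutator_eq1; rewrite ?(mxpow_unit (gp _)) //; apply: gC; exists i.
rewrite -prod_root_powM.
under eq_bigr do rewrite -xP.
(* The row product has two symbols, one computed factor by factor and one from [J] to the power
   [c i 0]; uniqueness equates them. *)
have := kron_symbol_prod (index_enum _) (fun j => kron_symbolX (A i j) (zP j)) Cg.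
rewrite gE mxpow_scalar => /kron_symbol_inj; apply.
apply: kron_symbol_scalar; exact: (root_pow_order omegaP).
Qed.

(** The scalar omega^a lies in T_(p), since its p equal diagonal entries multiply to 1; putting it
    in the first tensor factor suffices. *)
Lemma inKN_scalar (Q : 'M[Cplx]_p -> Prop) (a : 'I_p) :
  (forall S, inTpk p 1 S -> Q S) -> inKN Q k.+1 (w a)%:M.
Proof.
move=> QT; have QS : Q (w a)%:M.
  have wp := root_pow_order omegaP a.
  apply: QT; split; last by rewrite mxpow_scalar expn1 wp.
  exists (fun=> w a); split; last split=> [q|].
  - by rewrite Smx_monomial scalar_monomial.
  - by rewrite normrX norm_omega expr1n.
  - by rewrite prodr_const card_ord.
exists (fun i => if i is 0%N then (w a)%:M else 1%:M); split.
  case=> [|i] _; last exact: gen_one.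
  by apply: gen_gen; exists (w a)%:M, 0; rewrite mulmx1.
by rewrite /= kron_rec_scalar.
Qed.

(** Each generator goes to the scalar omega^(x_j): scalars commute, and the row relations become
    [A *m x = c] in the exponents. *)
Lemma classical_to_quantum r s (A : 'M['Z_p]_(r, s)) (c : 'cV['Z_p]_r)
    (Q : 'M[Cplx]_p -> Prop) :
    (forall S, inTpk p 1 S -> Q S) -> has_classical_solution A c ->
  has_quantum_solution A c Q k.+1.
Proof.
move=> QT [x xE]; have w1 : w (1 : 'I_p) = omega p by exact: expr1.
have wu (a : 'I_p) : (w a)%:M \in @unitmx _ (p ^ k.+1).
  by apply: (@mxpow_unit _ _ p.-1); rewrite mxpow_scalar (root_pow_order omegaP).
exists (fun j => (w (x j 0))%:M); rewrite /quantum_solution -w1; split.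
  exact: inKN_scalar.
split=> [j|]; first exact: inKN_scalar.
split=> [j|]; first by rewrite mxpow_scalar (root_pow_order omegaP).
split; first by rewrite mxpow_scalar (root_pow_order omegaP).
split=> [j|]; first by apply/commutator_eq1 => //; apply: comm_mx_scalar.
split=> [j j' _|i]; first by apply/commutator_eq1 => //; apply: comm_mx_scalar.
under eq_bigr do rewrite mxpow_scalar.
rewrite -(big_morph _ (@scalar_mxM _ _) (erefl _)) prod_root_powM.
rewrite mxpow_scalar w1 -xE mxE; congr _%:M.
Qed.

End Solutions.

Theorem theorem3 (p : nat) (hp : prime p) (hodd : odd p)
  (r s : nat) (A : 'M['Z_p]_(r, s)) (c : 'cV['Z_p]_r)
  (m : nat) (hm : (1 <= m)%N)
  (Q : 'M[Cplx]_p -> Prop)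
  (hQ : is_subgroup Q)
  (hTp : forall S, inTpk p 1 S -> Q S)
  (hTpm : forall S, Q S -> inTpk p m S)
  (hX : forall S, Q S -> Q (Xmx p *m S *m invmx (Xmx p)))
  (N : nat) (hN : (1 <= N)%N) :
  has_quantum_solution A c Q N <-> has_classical_solution A c.
Proof.
destruct p as [|[|n]] => //; destruct N as [|k] => //; split.
  by apply: quantum_to_classical => // S /hTpm [].
exact: classical_to_quantum.
Qed.
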